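(* Let $(\mathfrak X,\|\cdot\|)$ be a Banach space with dual $\mathfrak X^*$, let $(\Omega,d,\mathfrak L,\lambda)$ be a Borel regular metric measure space with the differentiation property, and let $\mathrm F:\mathfrak X\times\Omega\to\mathbb R$ be such that $\mathrm F(u,\cdot)\in L^\infty(\Omega,\lambda)$ for all $u\in\mathfrak X$ and $\mathrm F(\cdot,x)\in C^1(\mathfrak X)$ (in the Fréchet sense) for $\lambda$-a.e. $x\in\Omega$, with partial Fréchet differential $(\partial \mathrm F(\cdot,x))_u\in\mathfrak X^*$. Suppose that for every $v\in\mathfrak X$: (a) for every $\phi\in\mathfrak X$, $\lambda\text{-}\operatorname{ess\,sup}_{x\in\Omega}\big|[(\partial \mathrm F(\cdot,x))_w-(\partial \mathrm F(\cdot,x))_v](\phi)\big|\to0$ as $w\to v$ in $\mathfrak X$; (b) $\lambda\text{-}\operatorname{ess\,sup}_{x\in\Omega}|\mathrm F(w,x)-\mathrm F(v,x)|\to0$ as $w\to v$ in $\mathfrak X$. Then the Gateaux (right) semi-differential of the envelope function $f:\mathfrak X\to\mathbb R$, $f(u)=\lambda\text{-}\operatorname{ess\,sup}_{x\in\Omega}\mathrm F(u,x)$, can be represented as $$(\mathfrak D f)^+_u(\phi)=\operatorname*{ap\text{-}sup}_{x\in\lambda\text{-}\mathrm{Argmax}\{\mathrm F(u,\cdot)\,:\,\Omega\}}(\partial \mathrm F(\cdot,x))_u(\phi)$$ for any $u,\phi\in\mathfrak X$.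
   Context: $(\mathfrak D f)^+_u(\phi):=\lim_{t\to0^+}\frac{f(u+t\phi)-f(u)}{t}$. A Borel regular metric measure space with the differentiation property is $(\Omega,d,\mathfrak L,\lambda)$ where $d$ is a metric on $\Omega$, $(\Omega,\mathfrak L,\lambda)$ is a measure space with $\mathfrak L$ containing the Borel $\sigma$-algebra, every subset of $\Omega$ is contained in a Borel set of the same measure, non-empty open sets have positive $\lambda$-measure, and for any $g\in L^1_{\mathrm{loc}}(\Omega,\lambda)$, $g(x)=\lim_{\rho\to0}\frac1{\lambda(\mathbb B_\rho(x))}\int_{\mathbb B_\rho(x)}g\,d\lambda$ for $\lambda$-a.e. $x$. For $A\in\mathfrak L$, its measure-theoretic closure is $\overline A^\lambda:=\{x\in\Omega:\limsup_{\rho\to0}\lambda(\mathbb B_\rho(x)\cap A)/\lambda(\mathbb B_\rho(x))>0\}$. For a $\lambda$-measurable $g:\Omega\to\mathbb R$, the essential argmax set is $\lambda\text{-}\mathrm{Argmax}\{g:\Omega\}:=\bigcap_{\varepsilon>0}\overline{\{g\ge\lambda\text{-}\operatorname{ess\,sup}_\Omega g-\varepsilon\}}^\lambda$. For $g$ $\lambda$-essentially bounded above and $G:\Omega\to\mathbb R$ $\lambda$-measurable, the approximate supremum of $G$ over the essential argmax set of $g$ is defined as $$\operatorname*{ap\text{-}sup}_{\lambda\text{-}\mathrm{Argmax}\{g:\Omega\}}G:=\lim_{\varepsilon\to0^+}\Big(\lambda\text{-}\operatorname*{ess\,sup}_{\{g\ge\lambda\text{-}\operatorname{ess\,sup}_\Omega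 g-\varepsilon\}}G\Big).$$ *)

(* Defs.v *)
(* MathComp-Analysis. *)
From HB Require Import structures.
From mathcomp Require Import all_boot all_order all_algebra.
From mathcomp Require Import all_classical all_reals all_analysis.
From mathcomp Require Import ess_sup_inf hoelder.

Set Implicit Arguments.
Unset Strict Implicit.
Unset Printing Implicit Defensive.

Import Order.TTheory GRing.Theory Num.Theory.
Import numFieldNormedType.Exports.

Local Open Scope classical_set_scope.
Local Open Scope ring_scope.

(* The two structures are independent: the inclusion of the Borel sigma-algebra
   in the measurable sets is a hypothesis (see [borel_regular_differentiation]).
   Measurable types being pointed, the space is nonempty. *)
#[short(type="metricMeasurableType")]
HB.structure Definition MetricMeasurable (R : realType) (d : measure_display) :=
  {T of Metric R T & Measurable d T}.

Section metric_measure_space.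
Context (R : realType) (d : measure_display).
Context (Omega : metricMeasurableType R d).
Variable lam : {measure set Omega -> \bar R}.
Implicit Types (A B U : set Omega) (g G : Omega -> R).

Definition borel_set A : Prop := <<s @open Omega >> A.

(* Measurable, and integrable on a neighbourhood of every point. *)
Definition L1_loc g : Prop :=
  measurable_fun setT g /\
  forall x : Omega, exists2 r : R, 0 < r &
    lam.-integrable (ball x r) (EFin \o g).

(* [mu_ext lam] is the outer measure induced by [lam]; it gives its meaning to
   "the same measure" for a set [A] which need not be measurable. *)
Record borel_regular_differentiation : Prop := {
  borel_measurable : forall B, borel_set B -> measurable B ;
  borel_regular : forall A, exists B,
    [/\ borel_set B, A `<=` B & lam B = mu_ext lam A] ;
  open_measure_gt0 : forall U, open U -> U !=set0 -> (0 < lam U)%E ;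
  differentiation_property : forall g, L1_loc g ->
    \forall x \ae lam,
      ((lam (ball x rho))^-1 * \int[lam]_(y in ball x rho) (g y)%:E)%E
        @[rho --> 0^'+] --> (g x)%:E
}.

(* For [A] = setT this is the library's [ess_sup lam (EFin \o G)]. *)
Definition ess_sup_on A G : \bar R :=
  ereal_inf [set y | \forall x \ae lam, A x -> ((G x)%:E <= y)%E].

(* The approximate supremum of [G] over the essential argmax set of [g]: it is
   a function of [g] itself, through its superlevel sets. The limit exists in
   \bar R for all [g] and [G], since the essential supremum is monotone in
   [eps]. *)
Definition ap_sup_argmax g G : \bar R :=
  lim (ess_sup_on
         [set x | (ess_sup lam (EFin \o g) - eps%:E <= (g x)%:E)%E] G
       @[eps --> 0^'+]).

End metric_measure_space.

Section calculus.
Context (R : realType) (X : normedModType R).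
Implicit Types (f : X -> R) (u phi : X).

Definition dual_norm (l : X -> R) : \bar R :=
  ereal_sup [set `|l phi|%:E | phi in [set phi : X | `|phi| <= 1]].

Definition C1 f : Prop :=
  (forall u, differentiable f u) /\
  (forall v : X, (fun w : X => dual_norm (fun phi => 'd f w phi - 'd f v phi))
                   @ v --> 0%E).

Definition semi_quotient f u phi (t : R) : R := (f (u + t *: phi) - f u) / t.

Definition semi_differential f u phi : R :=
  lim (semi_quotient f u phi t @[t --> 0^'+]).

End calculus.

Definition envelope (R : realType) (d : measure_display)
    (Omega : measurableType d) (lam : {measure set Omega -> \bar R})
    (X : Type) (F : X -> Omega -> R) (u : X) : R :=
  fine (ess_sup lam (EFin \o F u)).

(* Main.v *)
Require Import Defs.
From HB Require Import structures.
From mathcomp Require Import all_boot all_order all_algebra.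
From mathcomp Require Import all_classical all_reals all_analysis.
From mathcomp Require Import ess_sup_inf hoelder.
From mathcomp Require Import lra.

(* Let g = F(u, .), M = ess sup g, G the derivative of F at u along phi.
   By (a), C^1-regularity and the mean value theorem,
   F(u + t phi, x) = g(x) + t G(x) + o(t) as t -> 0+, uniformly for a.e. x.
   With S(e) the essential supremum of G over {g >= M - e} and
   L = inf_e S(e): keeping only the points of that set gives
   f(u + t phi) >= M - e + t S(e) - o(t), and letting e -> 0 for fixed t,
   the difference quotient is at least L - o(1). Conversely, once
   t (ess sup |G| - S(e)) <= e, the points outside that set do not contribute,
   so the quotient is at most S(e) + o(1). *)

Set Implicit Arguments.
Unset Strict Implicit.
Unset Printing Implicit Defensive.

Import Order.TTheory GRing.Theory Num.Theory.
Import numFieldNormedType.Exports.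

Local Open Scope classical_set_scope.
Local Open Scope ring_scope.

(** * Countable families of null sets, and passing from rational to real points *)

Lemma ae_forall_countable (R : realType) (d : measure_display)
    (T : measurableType d) (mu : {measure set T -> \bar R}) (I : countType)
    (P : I -> T -> Prop) :
  (forall i, \forall x \ae mu, P i x) -> \forall x \ae mu, forall i, P i x.
Proof.
move=> aeP.
have : \forall x \ae mu, forall n : nat,
    if unpickle n is Some i then P i x else True.
  by apply: ae_foralln => n; case: unpickle => [i|]; [exact: aeP|exact: aeW].
by apply: filterS => x Px i; have := Px (pickle i); rewrite pickleK.
Qed.

(** A value above [c] would persist near [s] by continuity, hence at some rational of the
    interval. *)
Lemma le_itvoo_rat (R : realType) (h : R -> R) (a b c : R) :
  (forall s, s \in `]a, b[ -> {for s, continuous h}) ->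
  (forall q : rat, ratr q \in `]a, b[ -> h (ratr q) <= c) ->
  forall s, s \in `]a, b[ -> h s <= c.
Proof.
move=> hcont hrat s sab; rewrite leNgt; apply/negP => cs.
have near_s : \forall r \near s, (r \in `]a, b[) /\ c < h r.
  near=> r; split; near: r; first exact: near_in_itvoo.
  exact: (cvgr_gt (h s) (hcont _ sab)).
have [e /= e0 se] := near_s.
have [] := @rat_in_itvoo R (s - e) (s + e); first by lra.
move=> q.
rewrite in_itv /= => /andP[q1 q2].
have [|qab] := se (ratr q); first by rewrite /= ltr_distlC q1 q2.
by rewrite ltNge (hrat _ qab).
Unshelve. all: by end_near. Qed.

(** * Derivatives along lines and continuity of the differential *)

Section calculus_facts.
Context (R : realType) (X : normedModType R).
Implicit Types (f : X -> R) (u v phi : X).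

Lemma is_derive_line f u phi (s : R) : differentiable f (u + s *: phi) ->
  is_derive s (1 : R) (fun r : R => f (u + r *: phi)) ('d f (u + s *: phi) phi).
Proof.
move=> df; have dfphi : derivable f (u + s *: phi) phi by exact: diff_derivable.
have lineE : (fun r : R => r^-1 *: (f (u + (r *: (1 : R) + s) *: phi)
                                    - f (u + s *: phi)))
    = (fun r : R => r^-1 *: (f (r *: phi + (u + s *: phi)) - f (u + s *: phi))).
  apply/funext => r; congr (_ *: (f _ - _)).
  by rewrite scalerDl -scalerA scale1r addrCA.
apply: DeriveDef.
  by rewrite /derivable lineE.
by rewrite -deriveE// /derive lineE.
Qed.

(** Normalizing [phi] reduces to the unit ball. Since [dual_norm] accepts arbitrary functions,
    homogeneity of [l] has to be assumed. *)
Lemma le_dual_norm (l : X -> R) (phi : X) (e : R) :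
  (forall k psi, l (k *: psi) = k * l psi) ->
  (dual_norm l <= e%:E)%E -> `|l phi| <= e * `|phi|.
Proof.
move=> lZ le; have [->|phi0] := eqVneq phi 0.
  by rewrite -(scale0r phi) lZ mul0r scale0r !normr0 mulr0.
have nphi : 0 < `|phi| by rewrite normr_gt0.
have : `|l (`|phi|^-1 *: phi)| <= e.
  rewrite -lee_fin; apply: le_trans le; apply: ereal_sup_ubound.
  exists (`|phi|^-1 *: phi) => //=.
  by rewrite normrZ ger0_norm ?invr_ge0// mulVf ?gt_eqF.
by rewrite lZ normrM ger0_norm ?invr_ge0// ler_pdivrMl// mulrC.
Qed.

Lemma C1_continuous_diff f phi : C1 f -> continuous (fun w => 'd f w phi).
Proof.
move=> [df cf] v; apply/cvgrPdist_le => e e0.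
(* Adding 1 keeps the divisor positive when [phi] is zero. *)
have p0 : 0 < `|phi| + 1 by rewrite ltr_wpDl.
have ep0 : 0 < e / (`|phi| + 1) by rewrite divr_gt0.
have : \forall w \near v,
    (dual_norm (fun psi => 'd f w psi - 'd f v psi)%R < (e / (`|phi| + 1))%:E)%E.
  apply: (cf v [set y | (y < (e / (`|phi| + 1))%:E)%E]); apply: open_nbhs_nbhs.
  by split; [exact: open_ereal_lt_ereal|rewrite /= lte_fin].
apply: filterS => w /ltW /(@le_dual_norm _ phi) le.
rewrite distrC; apply: (le_trans (le _)) => [k psi|].
  by rewrite !linearZ /= -scalerDr.
by rewrite -mulrA ler_piMr ?ltW// mulrC ltr_pdivrMr// mul1r ltrDl.
Qed.

End calculus_facts.

(** * Essential suprema over a subset *)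

Section ess_sup_on_facts.
Context (R : realType) (d : measure_display).
Context (Omega : metricMeasurableType R d).
Variable lam : {measure set Omega -> \bar R}.
Implicit Types (A : set Omega) (g G : Omega -> R).

Lemma ess_sup_onP A G (y : \bar R) :
  (ess_sup_on lam A G <= y)%E <->
  \forall x \ae lam, A x -> ((G x)%:E <= y)%E.
Proof.
(* Extending [G] by -oo outside [A] turns [ess_sup_on] into an ordinary essential supremum, so that
   the infimum defining it is attained. *)
pose GA := (fun x => if x \in A then (G x)%:E else -oo%E).
have GAP x z : (GA x <= z)%E = (A x -> ((G x)%:E <= z)%E) :> Prop.
  apply/propext; rewrite /GA; case: ifPn => [|/negP].
    by rewrite inE => Ax; split => // /(_ Ax).
  by rewrite inE leNye => NAx; split.
have -> : ess_sup_on lam A G = ess_sup lam GA.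
  congr ereal_inf; apply/funext => z /=; congr (almost_everywhere lam _).
  by apply/funext => x; rewrite /= GAP.
have -> : (\forall x \ae lam, A x -> ((G x)%:E <= y)%E)
    = (\forall x \ae lam, (GA x <= y)%E).
  by congr (almost_everywhere lam _); apply/funext => x; rewrite /= GAP.
by split => /ess_supP.
Qed.

Lemma le_ess_sup_on A B G : A `<=` B ->
  (ess_sup_on lam A G <= ess_sup_on lam B G)%E.
Proof.
move=> AB; apply/ess_sup_onP.
by have /ess_sup_onP := lexx (ess_sup_on lam B G); apply: filterS => x + /AB.
Qed.

End ess_sup_on_facts.

(** * Finiteness of essential suprema; on a null space they would all be -oo *)

Section essentially_bounded.
Context (R : realType) (d : measure_display) (T : measurableType d).
Variable mu : {measure set T -> \bar R}.
Hypothesis mu_gt0 : (0 < mu setT)%E.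
Implicit Types (f : T -> R).

Lemma Lfun_oo_bounded f : f \in Lfun mu +oo%E ->
  exists M, \forall x \ae mu, `|f x| <= M.
Proof.
move=> /sub_Lfun_finLfun; rewrite inE /= /finite_norm unlock mu_gt0.
exact: (@ess_supr_bounded _ _ _ mu (fun x => `|f x|)).
Qed.

Lemma ess_sup_fin_num f (M : R) :
  (\forall x \ae mu, `|f x| <= M) -> ess_sup mu (EFin \o f) \is a fin_num.
Proof.
move=> fM; rewrite fin_numElt; apply/andP; split.
  apply: (@lt_le_trans _ _ (- M)%:E); first exact: ltNyr.
  apply: ess_sup_gee => //; apply: filterS fM => x.
  by rewrite ler_norml lee_fin => /andP[].
apply: (@le_lt_trans _ _ M%:E); last exact: ltry.
apply/ess_supP; apply: filterS fM => x.
by rewrite ler_norml lee_fin => /andP[].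
Qed.

End essentially_bounded.

(** * First-order behaviour of the essential supremum along a curve of functions *)

Section envelope_of_curve.
Context (R : realType) (d : measure_display).
Context (Omega : metricMeasurableType R d).
Variable lam : {measure set Omega -> \bar R}.
Variables (g G : Omega -> R) (H : R -> Omega -> R) (K : R).
Hypothesis g_fin : ess_sup lam (EFin \o g) \is a fin_num.
Hypothesis H_fin : forall t, ess_sup lam (EFin \o H t) \is a fin_num.
Hypothesis G_bounded : \forall x \ae lam, `|G x| <= K.
Hypothesis H_expansion : forall eta : R, 0 < eta -> \forall t \near 0^'+,
  \forall x \ae lam, `|H t x - g x - t * G x| <= eta * t.

Let M := fine (ess_sup lam (EFin \o g)).
Let m t := fine (ess_sup lam (EFin \o H t)).
Let A (e : R) := [set x | (ess_sup lam (EFin \o g) - e%:E <= (g x)%:E)%E].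
Let S (e : R) := ess_sup_on lam (A e) G.
Let s e := fine (S e).

Let AE e x : A e x <-> M - e <= g x.
Proof. by rewrite /A /= -(fineK g_fin) -EFinB lee_fin. Qed.

Let g_le : \forall x \ae lam, g x <= M.
Proof.
by apply: filterS (ess_sup_ge lam (EFin \o g)) => x; rewrite -(fineK g_fin) lee_fin.
Qed.

Let H_le t : \forall x \ae lam, H t x <= m t.
Proof.
by apply: filterS (ess_sup_ge lam (EFin \o H t)) => x;
  rewrite -(fineK (H_fin t)) lee_fin.
Qed.

Let ess_sup_leR (f : Omega -> R) (c : R) : ess_sup lam (EFin \o f) \is a fin_num ->
  (\forall x \ae lam, f x <= c) -> fine (ess_sup lam (EFin \o f)) <= c.
Proof.
by move=> ffin fc; rewrite -lee_fin fineK//; apply/ess_supP; apply: filterS fc.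
Qed.

Let SK e : 0 < e -> ((- K)%:E <= S e <= K%:E)%E.
Proof.
move=> e0; apply/andP; split; last first.
  by apply/ess_sup_onP; apply: filterS G_bounded => x;
    rewrite ler_norml lee_fin => /andP[].
(* If [S e] were below [- K], the bound on [G] would make [A e] a null set. Then [g] would be at
   most [M - e] almost everywhere, against the choice of [M]. *)
rewrite leNgt; apply/negP => SK.
have /ess_sup_onP AS := lexx (S e).
have : M <= M - e.
  apply: ess_sup_leR => //; apply: filterS2 AS G_bounded => x AxS.
  rewrite ler_norml => /andP[KG _]; rewrite leNgt; apply/negP => /ltW /AE /AxS GS.
  by have := le_lt_trans GS SK; rewrite lte_fin ltNge KG.
by lra.
Qed.

Let S_fin e : 0 < e -> S e \is a fin_num.
Proof.
move=> /SK /andP[SK1 SK2]; rewrite fin_numElt (lt_le_trans _ SK1) ?ltNyr//.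
by rewrite (le_lt_trans SK2) ?ltry.
Qed.

Let SE e : 0 < e -> S e = (s e)%:E.
Proof. by move=> e0; rewrite fineK// S_fin. Qed.

Let S_homo e e' : e <= e' -> (S e <= S e')%E.
Proof. by move=> ee'; apply: le_ess_sup_on => x /AE Ax; apply/AE; lra. Qed.

Let l := ereal_inf [set S e | e in [set` `]0%R, +oo[%R]].

Let S_cvg : S e @[e --> 0^'+] --> l.
Proof. by apply: nondecreasing_at_right_cvge => // x y _ _; exact: S_homo. Qed.

Let l_le e : 0 < e -> (l <= S e)%E.
Proof. by move=> e0; apply: ereal_inf_lbound; exists e => //=; rewrite in_itv/= e0. Qed.

Let l_fin : l \is a fin_num.
Proof.
rewrite fin_numElt; apply/andP; split.
  apply: (@lt_le_trans _ _ (- K)%:E); first exact: ltNyr.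
  apply: le_ereal_inf_tmp => _ [e /= + <-].
  by rewrite in_itv/= andbT => /SK /andP[].
by apply: (le_lt_trans (l_le ltr01)); rewrite SE// ltry.
Qed.

Let L := fine l.

Let L_le e : 0 < e -> L <= s e.
Proof. by move=> e0; rewrite -lee_fin fineK// -SE// l_le. Qed.

Let s_near_L eta : 0 < eta -> exists2 e, 0 < e & s e < L + eta.
Proof.
move=> eta0.
have [_ [e /= + <-]] := lb_ereal_inf_adherent eta0 l_fin.
rewrite in_itv/= andbT => e0.
by rewrite SE// -[X in (X + _)%E](fineK l_fin) -EFinD lte_fin; exists e.
Qed.

Let G_le_s e : 0 < e -> \forall x \ae lam, M - e <= g x -> G x <= s e.
Proof.
move=> e0; have /ess_sup_onP := lexx (S e).
by apply: filterS => x + /AE Ax => /(_ Ax); rewrite SE// lee_fin.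
Qed.

Lemma quotient_ge eta : 0 < eta ->
  \forall t \near 0^'+, L - eta <= (m t - M) / t.
Proof.
move=> eta0; near=> t; have t0 : 0 < t by [].
have Ht : \forall x \ae lam, `|H t x - g x - t * G x| <= eta * t.
  by near: t; exact: H_expansion.
rewrite ler_pdivlMr//; apply/ler_addgt0Pr => e e0.
(* Here [t] is fixed and [e] arbitrary, so the error [e / t] disappears. The right-hand side bounds
   [G] on [A e], because there [t * G x <= H t x - g x + eta * t] with [H t x <= m t] and
   [g x >= M - e]. *)
suff : L <= (m t - M + e + eta * t) / t by rewrite ler_pdivlMr//; lra.
apply: (le_trans (L_le e0)); rewrite -lee_fin -SE//; apply/ess_sup_onP.
apply: filterS2 Ht (H_le t) => x; rewrite ler_norml => /andP[Hg _] Hm /AE Ax.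
by rewrite lee_fin ler_pdivlMr//; lra.
Unshelve. all: by end_near. Qed.

Lemma quotient_le eta : 0 < eta ->
  \forall t \near 0^'+, (m t - M) / t <= L + eta.
Proof.
(* One half of [eta] pays for replacing [L] by [s e], the other for the remainder of the
   expansion. *)
move=> eta0; have eta2 : 0 < eta / 2 by lra.
have [e e0 seL] := s_near_L eta2.
have Ks0 : 0 <= K - s e by have /andP[_] := SK e0; rewrite SE// lee_fin subr_ge0.
near=> t; have t0 : 0 < t by [].
have Ht : \forall x \ae lam, `|H t x - g x - t * G x| <= (eta / 2) * t.
  by near: t; exact: H_expansion.
(* This makes the points outside [A e] harmless: there [g x + t * G x] is below [M - e + t * K],
   hence below [M + t * s e]. The 1 added in the proof avoids dividing by zero when [K = s e]. *)
have te : t * (K - s e) <= e.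
  rewrite (@le_trans _ _ (t * (K - s e + 1)))//.
    by rewrite ler_wpM2l ?ltW//; lra.
  rewrite -ler_pdivlMr; last by lra.
  by near: t; apply: nbhs_right_le; rewrite divr_gt0//; lra.
have : m t <= M + t * s e + eta / 2 * t.
  apply: ess_sup_leR => //; near=> x.
  have : `|H t x - g x - t * G x| <= eta / 2 * t by near: x.
  have : `|G x| <= K by near: x.
  have gM : g x <= M by near: x.
  have Gs : M - e <= g x -> G x <= s e by near: x; exact: G_le_s.
  rewrite !ler_norml => /andP[_ GK] /andP[_ Hg].
  have [/Gs {}Gs|gMe] := leP (M - e) (g x).
    have : t * G x <= t * s e by rewrite ler_wpM2l// ltW.
    by lra.
  have : t * G x <= t * K by rewrite ler_wpM2l// ltW.
  by lra.
have : t * s e <= t * (L + eta / 2) by rewrite ler_wpM2l// ltW.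
by rewrite ler_pdivrMr//; lra.
Unshelve. all: by end_near. Qed.

Lemma cvg_envelope_quotient : exists2 r : R,
  ap_sup_argmax lam g G = r%:E &
  (fine (ess_sup lam (EFin \o H t)) - fine (ess_sup lam (EFin \o g))) / t
    @[t --> 0^'+] --> r.
Proof.
exists L.
  by rewrite fineK//; apply: cvg_lim S_cvg; exact: ereal_hausdorff.
apply/cvgrPdist_le => eta eta0.
apply: filterS2 (quotient_ge eta0) (quotient_le eta0) => t.
by rewrite ler_distlC => -> ->.
Qed.

End envelope_of_curve.

(** * The first-order expansion, uniform in almost every point *)

Section expansion.
Context (R : realType) (X : normedModType R) (d : measure_display).
Context (T : measurableType d) (mu : {measure set T -> \bar R}).
Variable F : X -> T -> R.
Hypothesis F_C1 : \forall x \ae mu, C1 (fun w : X => F w x).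

(** By the mean value theorem the remainder is [t] times the change of the derivative from [u] to
    [u + c *: phi], for some [c] between 0 and [t] depending on [x]. Hypothesis (a) bounds this
    change by [eta] near [u]. *)
Lemma uniform_expansion (u phi : X) (eta : R) :
  (fun w : X => ess_sup mu (fun x =>
    `|'d (fun z : X => F z x) w phi - 'd (fun z : X => F z x) u phi|%:E))
    @ u --> 0%E ->
  0 < eta -> \forall t \near 0^'+, \forall x \ae mu,
    `|F (u + t *: phi) x - F u x - t * 'd (fun z : X => F z x) u phi|
      <= eta * t.
Proof.
move=> dF_cvg eta0.
have line_cvg : (u + r *: phi) @[r --> (0 : R)] --> u.
  rewrite -[X in _ --> X]addr0 -[X in _ --> _ + X](scale0r phi).
  by apply: cvgD; [exact: cvg_cst|apply: cvgZr_tmp; exact: cvg_id].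
have : \forall w \near u, (ess_sup mu (fun x =>
    `|'d (fun z : X => F z x) w phi - 'd (fun z : X => F z x) u phi|%:E)
    < eta%:E)%E.
  apply: (dF_cvg [set y | (y < eta%:E)%E]); apply: open_nbhs_nbhs.
  by split; [exact: open_ereal_lt_ereal|rewrite /= lte_fin].
move=> /line_cvg [delta /= delta0 dF_lt].
near=> t; have t0 : 0 < t by [].
have t_delta : t < delta by near: t; exact: nbhs_right_lt.
(* The null set provided by (a) depends on the point of the segment, so only
   countably many points can be used; C^1-regularity recovers the others. *)
have dF_rat : \forall x \ae mu, forall q : rat, ratr q \in `]0, t[ ->
    `|'d (fun z : X => F z x) (u + ratr q *: phi) phi
      - 'd (fun z : X => F z x) u phi| <= eta.
  apply: ae_forall_countable => q.
  have [qt|] := boolP ((ratr q : R) \in `]0, t[); last by move=> _; exact: aeW.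
  have /ltW /ess_supP : (ess_sup mu (fun x =>
      `|'d (fun z : X => F z x) (u + ratr q *: phi) phi
        - 'd (fun z : X => F z x) u phi|%:E) < eta%:E)%E.
    apply: dF_lt => /=; move: qt; rewrite in_itv /= sub0r normrN => /andP[q0 qt].
    by rewrite gtr0_norm// (lt_trans qt).
  by apply: filterS => x; rewrite lee_fin.
apply: filterS2 F_C1 dF_rat => x Cx dFq.
have dline s : is_derive s (1 : R) (fun r : R => F (u + r *: phi) x)
    ('d (fun z : X => F z x) (u + s *: phi) phi).
  by apply: (@is_derive_line _ _ (fun z => F z x)); exact: Cx.1.
have [|c ct] := @MVT R (fun r => F (u + r *: phi) x)
    (fun s => 'd (fun z : X => F z x) (u + s *: phi) phi) 0 t t0.
  apply: continuous_subspaceT => s; apply: differentiable_continuous.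
  by apply/derivable1_diffP; case: (dline s).
rewrite scale0r addr0 subr0 => ->.
rewrite [X in X - _]mulrC -mulrBr normrM (gtr0_norm t0) mulrC ler_wpM2r ?(ltW t0)//.
(* As [c] varies with [x] and may be irrational, the bound at rational points is extended to the
   whole segment by continuity. *)
move: c ct; apply: (@le_itvoo_rat _ (fun r => `|'d (fun z : X => F z x)
   (u + r *: phi) phi - 'd (fun z : X => F z x) u phi|)) => // s _.
apply: cvg_norm; apply: cvgB; last exact: cvg_cst.
apply: (@continuous_comp _ _ _ (fun r : R => u + r *: phi)
  (fun w => 'd (fun z : X => F z x) w phi)); last exact: C1_continuous_diff.
by apply: cvgD; [exact: cvg_cst|apply: cvgZr_tmp; exact: cvg_id].
Unshelve. all: by end_near. Qed.

End expansion.

Theorem corollary31 (R : realType) (X : completeNormedModType R)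
    (d : measure_display) (Omega : metricMeasurableType R d)
    (lam : {measure set Omega -> \bar R})
    (hOmega : borel_regular_differentiation lam)
    (F : X -> Omega -> R)
    (F_Linfty : forall u : X, F u \in Lfun lam +oo%E)
    (F_C1 : \forall x \ae lam, C1 (fun w : X => F w x))
    (F_a : forall v phi : X,
      (fun w : X => ess_sup lam (fun x : Omega =>
        `|'d (fun z : X => F z x) w phi - 'd (fun z : X => F z x) v phi|%:E))
        @ v --> 0%E)
    (F_b : forall v : X,
      (fun w : X => ess_sup lam (fun x : Omega => `|F w x - F v x|%:E))
        @ v --> 0%E) :
  (forall u : X, ess_sup lam (EFin \o F u) \is a fin_num) /\
  (forall u phi : X,
    cvg (semi_quotient (envelope lam F) u phi t @[t --> 0^'+]) /\
    (semi_differential (envelope lam F) u phi)%:E =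
      ap_sup_argmax lam (F u)
        (fun x : Omega => 'd (fun w : X => F w x) u phi)).
Proof.
(* The carrier is pointed, so the whole space is a non-empty open set. *)
have lam_gt0 : (0 < lam setT)%E.
  by apply: (open_measure_gt0 hOmega); [exact: openT|exists point].
have fin u : ess_sup lam (EFin \o F u) \is a fin_num.
  have [M FM] := Lfun_oo_bounded lam_gt0 (F_Linfty u).
  exact: ess_sup_fin_num FM.
split=> // u phi.
have expansion eta := @uniform_expansion _ _ _ _ lam F F_C1 u phi eta (F_a u phi).
(* Essential boundedness of the derivative is read off from the expansion with [eta = 1] at a single
   [t > 0]: [t] times its absolute value is at most [B + B' + t], where [B] and [B'] bound [F] at
   the two endpoints. *)
have [K dFK] : exists K, \forall x \ae lam, `|'d (fun w => F w x) u phi| <= K.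
  have [B FB] := Lfun_oo_bounded lam_gt0 (F_Linfty u).
  have [t [t0 dF]] : exists t : R, 0 < t /\ \forall x \ae lam,
      `|F (u + t *: phi) x - F u x - t * 'd (fun z : X => F z x) u phi| <= 1 * t.
    apply: (@filter_ex _ (0 : R)^'+); apply: filterI; first exact: nbhs_right_gt.
    exact: expansion.
  have [B' FB'] := Lfun_oo_bounded lam_gt0 (F_Linfty (u + t *: phi)).
  exists ((B + B' + t) / t); near=> x.
  have FuB : `|F u x| <= B by near: x.
  have FtB : `|F (u + t *: phi) x| <= B' by near: x.
  have : `|F (u + t *: phi) x - F u x - t * 'd (fun z : X => F z x) u phi|
      <= 1 * t by near: x.
  rewrite ler_pdivlMr// -[X in _ * X <= _](gtr0_norm t0) -normrM.
  rewrite [X in `|X| <= _ + _]mulrC.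
  move: FuB FtB; rewrite !ler_norml.
  by move=> /andP[? ?] /andP[? ?] /andP[? ?]; lra.
have [r apE q_cvg] := cvg_envelope_quotient (fin u)
  (fun t => fin (u + t *: phi)) dFK expansion.
split; first by apply/cvg_ex; exists r.
by rewrite apE; congr EFin; apply: cvg_lim q_cvg; exact: Rhausdorff.
Unshelve. all: by end_near. Qed.
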